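(* Let $d,m\ge 1$, $A\in\mathbb{Z}^{m\times d}$, $b\in\mathbb{Z}^m$, and let $C=(V,q,o)$ be a symbolic cone with $V\in\mathbb{Z}^{(d+m)\times d}$, $q\in\mathbb{R}^{d+m}$ and $o=0\in\{0,1\}^d$, such that the columns of $V$ are primitive and linearly independent, $C$ is forward, and \[ [C]=\{x\in\mathbb{R}^{d+m} : \begin{pmatrix} A & -\mathrm{Id}_m\end{pmatrix}x=b \text{ and } \begin{pmatrix}\mathrm{Id}_d & 0\end{pmatrix}x\ge 0\}. \] Write $M=\begin{pmatrix} A & -\mathrm{Id}_m\end{pmatrix}\in\mathbb{Z}^{m\times(d+m)}$. Then for every $i=0,\dots,m$, every symbolic cone $C'=(V',q',o')$ produced at iteration $i$ of $\mathrm{Elim}(C)$ is the forward cone determined by a system $A'x=b'$, $A''x\ge b''$ in $\mathbb{R}^{d+m-i}$, and (for a suitable ordering of the rows of $A''$) \[ [C']=\{x\in\mathbb{R}^{d+m-i} : A'x=b',\ A''x\ge^{o'}b''\}, \] where $A'\in\mathbb{Z}^{(m-i)\times(d+m-i)}$ is the submatrix of $M$ consisting of rows $1,\dots,m-i$ and columns $1,\dots,d+m-i$, $b'=(b_1,\dots,b_{m-i})$, and $A''x\ge b''$ (with $A''\in\mathbb{Z}^{d\times(d+m-i)}$, $b''\in\mathbb{Z}^d$) is a subsystem consisting of $d$ rows of the system \[ \begin{pmatrix}\mathrm{Id}_{d\times(d+m-i)}\\ M_{[m-i+1..m],[1..d+m-i]}\end{pmatrix}x\ \ge\ \begin{pmatrix}0_d\\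 (b_{m-i+1},\dots,b_m)\end{pmatrix}, \] with $\mathrm{Id}_{d\times(d+m-i)}$ the rectangular matrix with ones on the diagonal and zeros elsewhere and $M_{[m-i+1..m],[1..d+m-i]}$ the submatrix of $M$ of rows $m-i+1,\dots,m$ and columns $1,\dots,d+m-i$.
   Context: A symbolic cone is a triple $C=(V,q,o)$ with $V\in\mathbb{Z}^{n\times k}$ having linearly independent columns $v_1,\dots,v_k$, $q\in\mathbb{Q}^n$ (the apex) and $o\in\{0,1\}^k$; it represents the set $[C]=\{q+\sum_j\lambda_jv_j:\lambda_j\ge0 \text{ if } o_j=0,\ \lambda_j>0 \text{ if } o_j=1\}$. A nonzero integer vector is primitive if the gcd of its entries is 1; for a nonzero integer vector $v$, $\mathrm{prim}(v)=v/|\gcd(v_1,\dots,v_n)|$, and for a matrix prim is applied to each column. A vector is forward if its first nonzero entry is positive; a symbolic cone is forward if all its generators (columns of $V$) are forward. $\mathrm{Flip}(V,q,o)=(V',q,o')$ where $V'$ is obtained by multiplying each non-forward column by $-1$ and $o'_j=1-o_j$ if column $j$ was reversed, $o'_j=o_j$ otherwise; $\mathrm{sgn}(C)=(-1)^{\#\text{non-forward columns}}$. Let $\pi$ forget the last coordinate (on matrices: delete the last row). $\mathrm{sg}(x)=1$ if $x\ge0$ and $-1$ otherwise. ElimLC: for a symbolic cone $C=(V,q,o)$, $V\in\mathbb{Z}^{n\times k}$, such that $\pi$ restricted to the affine hull of $[C]$ is a bijection onto $\mathbb{R}^{n-1}$: put $w_j=q-\frac{q_n}{v_{j,n}}v_j$,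 $J^+=\{j:v_{j,n}>0\}$, $J^-=\{j:v_{j,n}<0\}$, $o'(j)$ equal to $o$ with $j$-th entry set to $0$; $T^j$ the $k\times k$ matrix with $(l,l)$ entry $-v_{j,n}$ for $l\ne j$, $(j,j)$ entry $-1$, $(j,l)$ entry $v_{l,n}$ for $l\neq j$, and all other entries $0$; $G^j=\mathrm{prim}(\pi(\mathrm{sg}(q_n)\,V\,T^j))$. If $q_n\ge0$ let $B=\{(G^j,\pi(w_j),o'(j)):j\in J^-\}\cup\{(\mathrm{prim}(\pi(V)),\pi(q),o)\}$; if $q_n<0$ let $B=\{(G^j,\pi(w_j),o'(j)):j\in J^+\}$. The output of ElimLC$(C)$ is the formal linear combination $\sum_{C''\in B}\mathrm{sgn}(C'')\,\mathrm{Flip}(C'')$. Elim$(C)$ (for $C$ in $\mathbb{R}^{d+m}$): start from the linear combination $1\cdot C$; in each of $m$ iterations replace each term $\alpha C_i$ by $\alpha\cdot$ElimLC$(C_i)$ and collect equal symbolic cones (columns of generator matrices are kept in lexicographically sorted order, permuting $o$ accordingly, so each cone has a unique representation), summing multiplicities. The cones ''produced at iteration $i$'' are those in the linear combination after $i$ iterations (iteration $0$: just $C$). Given $A'\in\mathbb{Z}^{p\times n}$, $b'\in\mathbb{Z}^p$, $A''\in\mathbb{Z}^{d\times n}$, $b''\in\mathbb{Z}^d$, $n=d+p$, such that $K=\{x:A'x=b',A''x\ge b''\}$ is a $d$-dimensional simplicial cone, the cone determined by the system is $(V,q,0)$ where the columns of $V$ are the unique primitive integer generators of the extreme rays of $K$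 and $q$ is the unique solution of $A'q=b'$, $A''q=b''$; the forward cone determined by the system is Flip of this cone. For scalars $\alpha\ge^0\beta$ means $\alpha\ge\beta$ and $\alpha\ge^1\beta$ means $\alpha<\beta$; for vectors $u\ge^o v$ means $u_i\ge^{o_i}v_i$ for all $i$. The ordering of rows of $A''$ is such that the $i$-th generator lies on the ray where all constraints of $A''x\ge^{o'}b''$ hold with equality except the $i$-th. *)

(* Defs.v *)
From mathcomp Require Import all_boot all_order all_algebra.
From mathcomp Require Import boolp classical_sets reals.

Set Implicit Arguments.
Unset Strict Implicit.
Unset Printing Implicit Defensive.

Import Order.TTheory GRing.Theory Num.Theory.
Local Open Scope ring_scope.
Local Open Scope classical_set_scope.

Definition toR (R : realType) (m n : nat) (A : 'M[int]_(m, n)) : 'M[R]_(m, n) :=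
  map_mx intr A.

Definition col_gcd (n : nat) (v : 'cV[int]_n) : nat :=
  \big[gcdn/0%N]_(i < n) `|v i 0%R|%N.

Definition primitive (n : nat) (v : 'cV[int]_n) : bool :=
  (v != 0) && (col_gcd v == 1%N).

Definition prim (n k : nat) (V : 'M[int]_(n, k)) : 'M[int]_(n, k) :=
  \matrix_(i, j) (V i j %/ (col_gcd (col j V))%:Z)%Z.

Definition forward (n : nat) (v : 'cV[int]_n) : bool :=
  [exists i : 'I_n, (0 < v i 0) && [forall l : 'I_n, (l < i)%N ==> (v l 0 == 0)]].

(* A triple (V, q, o); linear independence of the columns of V is the separate
   predicate [symbolic_cone]. *)
Definition symcone (R : realType) (n k : nat) : Type :=
  ('M[int]_(n, k) * 'cV[R]_n * {ffun 'I_k -> bool})%type.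

Section SymbolicCones.
Variable R : realType.

Definition gens n k (C : symcone R n k) : 'M[int]_(n, k) := C.1.1.
Definition apex n k (C : symcone R n k) : 'cV[R]_n := C.1.2.
Definition openness n k (C : symcone R n k) : {ffun 'I_k -> bool} := C.2.

Definition symbolic_cone n k (C : symcone R n k) : Prop :=
  row_free (toR R (gens C))^T.

Definition forward_cone n k (C : symcone R n k) : Prop :=
  forall j, forward (col j (gens C)).

Definition cone_set n k (C : symcone R n k) : set 'cV[R]_n :=
  [set x | exists2 lam : 'I_k -> R,
     forall j, if openness C j then 0 < lam j else 0 <= lam j &
     x = apex C + \sum_j lam j *: toR R (col j (gens C))].

Definition Flip n k (C : symcone R n k) : symcone R n k :=
  (\matrix_(i, j) (if forward (col j (gens C)) then gens C i j
                   else - gens C i j),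
   apex C,
   [ffun j => if forward (col j (gens C)) then openness C j
              else ~~ openness C j]).

Definition sgn n k (C : symcone R n k) : int :=
  (-1) ^+ #|[pred j : 'I_k | ~~ forward (col j (gens C))]|.

Definition proj_last (T : Type) n k (A : 'M[T]_(n.+1, k)) : 'M[T]_(n, k) :=
  row' ord_max A.

Definition sg (x : R) : int := if 0 <= x then 1 else -1.

(* A formal linear combination is the list of its (multiplicity, cone) terms. *)
Definition lincomb (T : Type) : Type := seq (int * T).

Definition collect (T : eqType) (L : lincomb T) : lincomb T :=
  [seq (\sum_(t <- L | t.2 == x) t.1, x) | x <- undup (unzip2 L)].

Definition col_lexle n k (V : 'M[int]_(n, k)) (j l : 'I_k) : bool :=
  ([seq V i j | i : 'I_n] <= [seq V i l | i : 'I_n] :> seqlexi int)%O.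

Definition lex_sort n k (C : symcone R n k) : symcone R n k :=
  let s := [tuple of sort (col_lexle (gens C)) (ord_tuple k)] in
  (colsub (tnth s) (gens C), apex C, [ffun j => openness C (tnth s j)]).

Section ElimLC.
Variables (n k : nat) (C : symcone R n.+1 k).
Let V := gens C.
Let q := apex C.
Let o := openness C.
Let qn : R := q ord_max 0.
Let vn (j : 'I_k) : int := V ord_max j.

Definition elim_apex (j : 'I_k) : 'cV[R]_n.+1 :=
  q - (qn / (vn j)%:~R) *: toR R (col j V).

Definition elim_mx (j : 'I_k) : 'M[int]_k :=
  \matrix_(a, l) if a == j then (if l == j then -1 else vn l)
                 else (if l == a then - vn j else 0).

Definition elim_open (j : 'I_k) : {ffun 'I_k -> bool} :=
  [ffun l => if l == j then false else o l].

Definition elim_piece (j : 'I_k) : symcone R n k :=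
  (prim (proj_last (sg qn *: (V *m elim_mx j))),
   proj_last (elim_apex j), elim_open j).

Definition elim_base : symcone R n k := (prim (proj_last V), proj_last q, o).

(* The set B; [undup] because it is a set and not a multiset of cones. *)
Definition elim_cones : seq (symcone R n k) :=
  undup (if 0 <= qn
         then rcons [seq elim_piece j | j <- enum 'I_k & vn j < 0] elim_base
         else [seq elim_piece j | j <- enum 'I_k & 0 < vn j]).

Definition ElimLC : lincomb (symcone R n k) :=
  [seq (sgn D, Flip D) | D <- elim_cones].

End ElimLC.

Definition elim_step n k (L : lincomb (symcone R n.+1 k)) :
    lincomb (symcone R n k) :=
  collect (flatten [seq [seq (t.1 * u.1, lex_sort u.2) | u <- ElimLC t.2]
                   | t <- L]).

(* In dimension 0 there is no coordinate left to eliminate. *)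
Definition elim_step_pred n k :
    lincomb (symcone R n k) -> lincomb (symcone R n.-1 k) :=
  match n with
  | 0 => fun=> [::]
  | n'.+1 => fun L => elim_step L
  end.

(* The linear combination after i iterations. The casts only transport along
   N = N - 0 and (N - i).-1 = N - i.+1. *)
Fixpoint Elim N k (C : symcone R N k) (i : nat) : lincomb (symcone R (N - i) k) :=
  match i with
  | 0 => ecast n (lincomb (symcone R n k)) (esym (subn0 N)) [:: (1, C)]
  | i'.+1 => ecast n (lincomb (symcone R n k)) (esym (subnS N i'))
               (elim_step_pred (Elim C i'))
  end.

(* alpha >=^b beta: reversed and strict when b = 1. *)
Definition sge (b : bool) (alpha beta : R) : bool :=
  if b then alpha < beta else beta <= alpha.

Definition vge k (o : {ffun 'I_k -> bool}) (u v : 'cV[R]_k) : Prop :=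
  forall j, sge (o j) (u j 0) (v j 0).

Definition system_set p d n (A' : 'M[int]_(p, n)) (b' : 'cV[int]_p)
    (A'' : 'M[int]_(d, n)) (b'' : 'cV[int]_d) (o : {ffun 'I_d -> bool}) :
    set 'cV[R]_n :=
  [set x | toR R A' *m x = toR R b' /\ vge o (toR R A'' *m x) (toR R b'')].

Definition simplicial_cone n d (K : set 'cV[R]_n) : Prop :=
  exists (q : 'cV[R]_n) (U : 'M[R]_(n, d)), row_free U^T /\
    K = [set x | exists2 lam : 'I_d -> R, forall j, 0 <= lam j &
                 x = q + \sum_j lam j *: col j U].

Definition half_line n (q v : 'cV[R]_n) : set 'cV[R]_n :=
  [set x | exists2 lam : R, 0 <= lam & x = q + lam *: v].

(* A half-line that is a face of K. *)
Definition extreme_ray n (K F : set 'cV[R]_n) : Prop :=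
  [/\ exists q, exists2 v, v != 0 & F = half_line q v,
      F `<=` K
    & forall (x y : 'cV[R]_n) (t : R), K x -> K y -> 0 < t < 1 ->
        F (t *: x + (1 - t) *: y) -> F x /\ F y].

Section Determined.
Variables (p d n : nat).
Variables (A' : 'M[int]_(p, n)) (b' : 'cV[int]_p).
Variables (A'' : 'M[int]_(d, n)) (b'' : 'cV[int]_d).

Definition cone_determined (C : symcone R n d) : Prop :=
  let K := system_set A' b' A'' b'' [ffun=> false] in
  let ray j := half_line (apex C) (toR R (col j (gens C))) in
  [/\ n = (d + p)%N /\ simplicial_cone d K,
      forall x : 'cV[R]_n,
        (toR R A' *m x = toR R b' /\ toR R A'' *m x = toR R b'') <-> x = apex C,
      forall j, primitive (col j (gens C)) /\ extreme_ray K (ray j),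
      forall F, extreme_ray K F -> exists! j, F = ray j
    & openness C = [ffun=> false]].

Definition forward_cone_determined (C : symcone R n d) : Prop :=
  exists2 C0 : symcone R n d, cone_determined C0 & C = Flip C0.

(* The j-th generator of C spans the ray on which every constraint of
   A'' x >=^o b'' but the j-th is tight. *)
Definition rows_ordered (C : symcone R n d) : Prop :=
  forall (j : 'I_d) (lam : R), 0 < lam ->
    let x := apex C + lam *: toR R (col j (gens C)) in
    [/\ toR R A' *m x = toR R b',
        forall l, l != j -> (toR R A'' *m x) l 0 = toR R b'' l 0,
        (toR R A'' *m x) j 0 != toR R b'' j 0
      & sge (openness C j) ((toR R A'' *m x) j 0) (toR R b'' j 0)].

End Determined.

End SymbolicCones.

Definition ext_mx (d m : nat) (A : 'M[int]_(m, d)) : 'M[int]_(m, d + m) :=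
  row_mx A (- 1%:M).

(* 0-based: the row indices 0, ..., m-i-1. *)
Definition top_row (m i : nat) (him : (i <= m)%N) (r : 'I_(m - i)) : 'I_m :=
  cast_ord (subnK him) (lshift i r).

(* 0-based: the row indices m-i, ..., m-1. *)
Definition bottom_row (m i : nat) (him : (i <= m)%N) (r : 'I_i) : 'I_m :=
  cast_ord (subnK him) (rshift (m - i) r).

Definition first_col (d m i : nat) (c : 'I_(d + m - i)) : 'I_(d + m) :=
  widen_ord (leq_subr i (d + m)) c.

Definition eqs_mx (d m i : nat) (him : (i <= m)%N) (A : 'M[int]_(m, d)) :
    'M[int]_(m - i, d + m - i) :=
  mxsub (top_row him) (@first_col d m i) (ext_mx A).

Definition eqs_rhs (m i : nat) (him : (i <= m)%N) (b : 'cV[int]_m) :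
    'cV[int]_(m - i) :=
  rowsub (top_row him) b.

Definition ineqs_mx (d m i : nat) (him : (i <= m)%N) (A : 'M[int]_(m, d)) :
    'M[int]_(d + i, d + m - i) :=
  col_mx (pid_mx d) (mxsub (bottom_row him) (@first_col d m i) (ext_mx A)).

Definition ineqs_rhs (d m i : nat) (him : (i <= m)%N) (b : 'cV[int]_m) :
    'cV[int]_(d + i) :=
  col_mx 0 (rowsub (bottom_row him) b).

(* Main.v *)
Require Import Defs.
From mathcomp Require Import all_boot all_order all_algebra.
From mathcomp Require Import boolp classical_sets reals.
From mathcomp Require Import lra.

Set Implicit Arguments.
Unset Strict Implicit.
Unset Printing Implicit Defensive.

Import Order.TTheory GRing.Theory Num.Theory.
Local Open Scope ring_scope.
Local Open Scope classical_set_scope.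

(** Every cone occurring in the elimination is the truncation to the first
    [d + m - i] coordinates of a cone lying in the affine space
    [{x | ext_mx A *m x = b}] of [R^(d+m)], and on that space the admissible
    inequalities are exactly [x_c >= 0] for [c < d] or [c >= d + m - i]. The cone
    is described by [d] of these coordinates whose values on the generators form
    a diagonal matrix, the sign of each diagonal entry being given by the
    openness. Eliminating the last coordinate either keeps the chosen
    coordinates or exchanges one of them for the eliminated one, which is a
    pivot step; flipping a generator changes a diagonal sign together with its
    openness. A diagonal matrix of values makes the generators a dual basis, so
    they span the extreme rays of the simplicial cone cut out by the system. *)

(** * Primitive and forward integer vectors *)

Lemma dvdn_col_gcd n (v : 'cV[int]_n) (i : 'I_n) : (col_gcd v %| `|v i 0%R|)%N.
Proof. exact: (biggcdn_inf i). Qed.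

Lemma dvdn_col_gcdP n (v : 'cV[int]_n) (g : nat) :
  (forall i, (g %| `|v i 0%R|)%N) -> (g %| col_gcd v)%N.
Proof.
move=> gv; rewrite /col_gcd; elim/big_ind: _ => //.
by move=> x y gx gy; rewrite dvdn_gcd gx.
Qed.

Lemma col_gcd_eq0 n (v : 'cV[int]_n) : (col_gcd v == 0%N) = (v == 0).
Proof.
apply/eqP/eqP=> [v0 | ->].
  apply/colP=> i; rewrite mxE.
  by have := dvdn_col_gcd v i; rewrite v0 dvd0n absz_eq0 => /eqP.
by apply/eqP; rewrite -dvd0n; apply: dvdn_col_gcdP => i; rewrite mxE.
Qed.

Lemma prim_colE n k (V : 'M[int]_(n, k)) i j :
  V i j = prim V i j * (col_gcd (col j V))%:Z.
Proof.
rewrite mxE divzK //.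
by rewrite dvdzE /=; have := dvdn_col_gcd (col j V) i; rewrite mxE.
Qed.

(** The gcd of the divided column times the original gcd divides every original entry, hence the
    original gcd; cancelling this positive number leaves 1. *)
Lemma primitive_prim n k (V : 'M[int]_(n, k)) j :
  col j V != 0 -> primitive (col j (prim V)).
Proof.
move=> V0; have g0 : (0 < col_gcd (col j V))%N by rewrite lt0n col_gcd_eq0.
have g1 : col_gcd (col j (prim V)) = 1%N.
  have : (col_gcd (col j (prim V)) * col_gcd (col j V) %| col_gcd (col j V))%N.
    apply: dvdn_col_gcdP => i; rewrite mxE prim_colE abszM dvdn_mul //.
    by have := dvdn_col_gcd (col j (prim V)) i; rewrite mxE.
  by rewrite -[X in (_ %| X)%N]mul1n dvdn_pmul2r // dvdn1 => /eqP.
rewrite /primitive g1 eqxx andbT; apply/eqP=> p0.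
have /eqP : col_gcd (col j (prim V)) == 0%N by rewrite p0 col_gcd_eq0.
by rewrite g1.
Qed.

Lemma primitiveN n (v : 'cV[int]_n) : primitive (- v) = primitive v.
Proof.
rewrite /primitive oppr_eq0; congr (_ && (_ == _)).
by apply: eq_bigr => i _; rewrite mxE abszN.
Qed.

Lemma forward_neq0 n (v : 'cV[int]_n) : forward v -> v != 0.
Proof.
by case/existsP=> i /andP[vi _]; apply/eqP=> v0; rewrite v0 mxE ltxx in vi.
Qed.

(** The sign of the first nonzero entry alone decides forwardness, and that entry occupies the same
    place in [v] and [- v]. *)
Lemma forwardN n (v : 'cV[int]_n) : v != 0 -> forward (- v) = ~~ forward v.
Proof.
case/cV0Pn=> i0 vi0.
have [i vi imin] :=
  @arg_minnP _ i0 (fun i => v i 0 != 0) (fun i : 'I_n => i : nat) vi0.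
have v0 (l : 'I_n) : (l < i)%N -> v l 0 = 0.
  by move=> li; apply/eqP; apply: contraTT li => vl; rewrite -leqNgt; apply: imin.
have fE (w : 'cV[int]_n) : w i 0 != 0 -> (forall l : 'I_n, (l < i)%N -> w l 0 = 0) ->
    forward w = (0 < w i 0).
  move=> wi w0; apply/existsP/idP => [[l /andP[wl /forallP wl0]] | wi0].
    case: (ltngtP l i) => li; first by rewrite w0 // ltxx in wl.
      by have := wl0 i; rewrite li (negPf wi).
    by rewrite (ord_inj li) in wl.
  by exists i; rewrite wi0; apply/forallP=> l; apply/implyP=> /w0 ->.
rewrite !fE ?mxE ?oppr_eq0 //; last by move=> l /v0; rewrite mxE => ->; rewrite oppr0.
by rewrite oppr_gt0 ltNge le_eqVlt (eq_sym 0) (negPf vi).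
Qed.

(** * Half-lines and the extreme rays of a simplicial cone *)

Lemma ge0_of_half_line (R : realType) (a c : R) :
  (forall t, 0 <= t -> 0 <= a + t * c) -> 0 <= c.
Proof.
move=> ray; rewrite leNgt; apply/negP => c0.
(* With this [t], [a + t * c] equals [a] minus its absolute value minus 1, which is negative. *)
have t0 : 0 <= (`|a| + 1) / (- c).
  by rewrite divr_ge0 ?oppr_ge0 ?(ltW c0) // addr_ge0.
have := ray _ t0; rewrite invrN mulrN mulNr divfK ?lt_eqF // opprD addrA.
by have := ler_norm a; lra.
Qed.

Lemma sum_colE (R : realType) n d (U : 'M[R]_(n, d)) (l : 'I_d -> R) :
  \sum_j l j *: col j U = U *m \col_j l j.
Proof.
apply/colP=> c; rewrite summxE mxE; apply: eq_bigr => j _.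
by rewrite !mxE mulrC.
Qed.

Lemma toR_col (R : realType) n d (V : 'M[int]_(n, d)) j :
  toR R (col j V) = col j (toR R V).
Proof. exact: map_col. Qed.

Section SimplicialRays.
Variables (R : realType) (n d : nat) (q : 'cV[R]_n) (U : 'M[R]_(n, d)).
Hypothesis freeU : row_free U^T.

Let K : set 'cV[R]_n :=
  [set x | exists2 lam : 'I_d -> R, forall j, 0 <= lam j &
           x = q + \sum_j lam j *: col j U].

Let injU (a a' : 'cV[R]_d) : q + U *m a = q + U *m a' -> a = a'.
Proof.
move/addrI/(congr1 trmx); rewrite !trmx_mul => /(row_free_inj freeU).
exact: trmx_inj.
Qed.

(** Independent columns make coordinates unique, so [K] is treated as a nonnegative orthant from
    here on. *)
Let inK (a : 'cV[R]_d) : K (q + U *m a) <-> forall j, 0 <= a j 0.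
Proof.
split=> [[lam lam0] | a0].
  by rewrite sum_colE => /injU -> j; rewrite mxE.
exists (fun j => a j 0) => //; rewrite sum_colE; congr (_ + _ *m _).
by apply/colP=> j; rewrite mxE.
Qed.

Let KE x : K x -> exists2 a : 'cV[R]_d, forall j, 0 <= a j 0 & x = q + U *m a.
Proof.
case=> lam lam0 ->; rewrite sum_colE; exists (\col_j lam j) => // j.
by rewrite mxE.
Qed.

(** In coordinates: away from [j], a combination of nonnegative numbers with positive weights
    vanishes, so each of them vanishes. *)
Lemma generator_extreme_ray j : extreme_ray K (half_line q (col j U)).
Proof.
have rayE l : l *: col j U = U *m (l *: delta_mx j 0).
  by rewrite -scalemxAr -colE.
split.
- exists q, (col j U) => //; apply/eqP => c0.
  have : delta_mx j 0 = 0 :> 'cV[R]_d.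
    by apply: injU; rewrite -colE c0 mulmx0.
  by move/colP/(_ j); rewrite !mxE !eqxx => /eqP; rewrite oner_eq0.
- move=> x [l l0 ->]; rewrite rayE inK => k; rewrite !mxE.
  by rewrite mulr_ge0 ?ler0n.
- move=> x y t /KE[a a0 ->] /KE[b b0 ->] /andP[t0 t1] [l l0].
  have -> : t *: (q + U *m a) + (1 - t) *: (q + U *m b) =
            q + U *m (t *: a + (1 - t) *: b).
    rewrite mulmxDr -!scalemxAr !scalerDr addrACA -scalerDl.
    by rewrite addrC addrC subrKC scale1r.
  rewrite rayE => /injU /colP E.
  have ab k : k != j -> a k 0 = 0 /\ b k 0 = 0.
    move=> kj; have := E k; rewrite !mxE (negPf kj) mulr0 => /eqP.
    rewrite paddr_eq0 ?mulr_ge0 ?subr_ge0 ?(ltW t0) ?(ltW t1) //.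
    rewrite !mulf_eq0 subr_eq0 (gt_eqF t0) (gt_eqF t1) /=.
    by case/andP=> /eqP -> /eqP ->.
  have dE (c : 'cV[R]_d) : (forall k, k != j -> c k 0 = 0) ->
      c = c j 0 *: delta_mx j 0.
    move=> c0; apply/colP=> k; rewrite !mxE eqxx andbT.
    by case: eqVneq => [-> | /c0 ->]; rewrite ?mulr1 ?mulr0.
  split.
    by exists (a j 0) => //; rewrite rayE -dE // => k /ab[].
  by exists (b j 0) => //; rewrite rayE -dE // => k /ab[].
Qed.

(** In coordinates [F] is the half-line [a + t *: mu] with [a] and [mu] nonnegative. The face
    property makes every generator on which a point of [F] has a nonzero coordinate parallel to
    [mu]; this forces [a = 0] and leaves [mu] a single nonzero coordinate. *)
Lemma extreme_rayP F : extreme_ray K F -> exists! j, F = half_line q (col j U).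
Proof.
case=> [[q0 [v0 v00 FE]] FK face].
have rayE j l : l *: col j U = U *m (l *: delta_mx j 0).
  by rewrite -scalemxAr -colE.
have [a a0 qE] : exists2 a : 'cV[R]_d, forall j, 0 <= a j 0 & q0 = q + U *m a.
  by apply: KE; apply: FK; rewrite FE; exists 0; rewrite // scale0r addr0.
have [mu vE] : exists mu : 'cV[R]_d, v0 = U *m mu.
  have [c _ cE] : exists2 c : 'cV[R]_d, forall j, 0 <= c j 0 & q0 + v0 = q + U *m c.
    by apply: KE; apply: FK; rewrite FE; exists 1; rewrite // scale1r.
  exists (c - a); rewrite mulmxBr.
  by apply: (addrI q0); rewrite cE qE -addrA subrKC.
have lineE t : q0 + t *: v0 = q + U *m (a + t *: mu).
  by rewrite qE vE mulmxDr scalemxAr addrA.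
have inF z : F (q + U *m z) <-> exists2 t, 0 <= t & z = a + t *: mu.
  rewrite FE; split=> -[t t0 E]; exists t => //.
    by apply: injU; rewrite E lineE.
  by rewrite lineE E.
have mu0 j : 0 <= mu j 0.
  apply: (@ge0_of_half_line _ (a j 0)) => t t0.
  have : K (q + U *m (a + t *: mu)) by apply: FK; rewrite inF; exists t.
  by rewrite inK => /(_ j); rewrite !mxE.
have entE (z : 'cV[R]_d) e l k :
    (z + e *: delta_mx l 0) k 0 = z k 0 + e * (k == l)%:R.
  by rewrite !mxE eqxx andbT.
(* Every point of F is the midpoint of two points of K on a line parallel to
   the l-th generator. *)
have slide t l : 0 <= t -> exists2 s, 0 <= s &
    ((a + t *: mu) l 0) *: delta_mx l 0 = (t - s) *: mu.
  move=> t0; set z := a + t *: mu.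
  have z0 k : 0 <= z k 0 by rewrite !mxE addr_ge0 ?mulr_ge0.
  have := @face (q + U *m (z + z l 0 *: delta_mx l 0))
                (q + U *m (z - z l 0 *: delta_mx l 0)) 2^-1.
  case.
  - rewrite inK => k; rewrite entE addr_ge0 ?mulr_ge0 ?z0 ?ler0n //.
  - rewrite inK => k; rewrite -scaleNr entE.
    by case: eqVneq => [-> | _]; rewrite ?mulr1 ?subrr ?mulr0 ?addr0.
  - by apply/andP; split; lra.
  - suff -> (w : 'cV[R]_d) : 2^-1 *: (q + U *m (z + w)) +
        (1 - 2^-1) *: (q + U *m (z - w)) = q + U *m z by rewrite inF; exists t.
    have -> : 1 - 2^-1 = 2^-1 :> R by lra.
    rewrite -scalerDr addrACA -mulmxDr addrACA subrr addr0 -!mulr2n mulmxDr.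
    rewrite -!mulr2n -mulrnDl -scaler_nat scalerA mulVf ?scale1r //.
    by rewrite pnatr_eq0.
  (* The endpoint kept is the one with [z l 0] subtracted, hence the coefficient [t - s] and not
     [s - t]. *)
  move=> _; rewrite inF => -[s s0 sE]; exists s => //.
  rewrite scalerBl -[t *: mu](addKr a) -/z -[s *: mu](addKr a) -sE.
  by rewrite opprD opprK addrACA addNr add0r opprB addrC subrK.
have [j muj] : exists j, mu j 0 != 0.
  apply/cV0Pn; apply/eqP=> m0; move: v00.
  by rewrite vE m0 mulmx0 eqxx.
have mujp : 0 < mu j 0 by rewrite lt_def muj mu0.
have a_eq0 : a = 0.
  (* At the endpoint [t = 0] the coefficient is [- s], so [a l 0] is also nonpositive. *)
  apply/colP=> l; have [s s0] := slide 0 l (lexx _).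
  move/colP/(_ l); rewrite !mxE !eqxx mul0r addr0 mulr1 sub0r mulNr => aE.
  by apply/eqP; rewrite eq_le a0 andbT aE oppr_le0 mulr_ge0.
have muE : mu = mu j 0 *: delta_mx j 0.
  have [s s0 /colP E] := slide 1 j ler01.
  have s1 : 1 - s != 0.
    apply: contraTneq mujp => s1; have := E j.
    by rewrite s1 a_eq0 !mxE !eqxx mulr1 mul0r add0r mul1r => ->; rewrite ltxx.
  apply/colP=> k; rewrite !mxE eqxx andbT.
  case: eqVneq => [-> | kj]; rewrite ?mulr1 // mulr0.
  have := E k; rewrite !mxE (negPf kj) mulr0 => /esym/eqP.
  by rewrite mulf_eq0 (negPf s1) => /eqP.
exists j; split.
  rewrite FE; apply/seteqP; split=> x [t t0 ->].
    exists (t * mu j 0); rewrite ?mulr_ge0 // lineE a_eq0 add0r rayE.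
    by rewrite muE scalerA !mxE !eqxx mulr1.
  exists (t / mu j 0); rewrite ?divr_ge0 // lineE a_eq0 add0r rayE.
  by rewrite {2}muE scalerA divfK.
(* The point of [F] with parameter 1 has positive [j]-th coordinate, which is zero on every other
   ray. *)
move=> j'; rewrite predeqE => /(_ (q + U *m (a + 1 *: mu)))[+ _].
case; first by rewrite inF; exists 1.
move=> t t0; rewrite rayE => /injU/colP/(_ j).
rewrite a_eq0 add0r scale1r !mxE eqxx andbT.
by case: eqVneq => // _ m0; rewrite m0 mulr0 ltxx in mujp.
Qed.

End SimplicialRays.

(** * Inequality systems dual to a family of generators *)

Section DualSystem.
Variables (R : realType) (p d n : nat).
Variables (A' : 'M[int]_(p, n)) (b' : 'cV[int]_p).
Variables (A'' : 'M[int]_(d, n)) (b'' : 'cV[int]_d).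
Hypotheses (n_def : n = (d + p)%N) (freeA' : row_free (toR R A')).

(* Up to scaling, the columns of U form the basis of the kernel of A' that is
   dual to the rows of A'', with signs prescribed by o. *)
Record dual_system (q : 'cV[R]_n) (U : 'M[R]_(n, d)) (o : {ffun 'I_d -> bool}) :
    Prop := DualSystem {
  dual_eqs : toR R A' *m U = 0;
  dual_apex_eqs : toR R A' *m q = toR R b';
  dual_apex_ineqs : toR R A'' *m q = toR R b'';
  dual_offdiag : forall l j, l != j -> (toR R A'' *m U) l j = 0;
  dual_sign : forall j, if o j then (toR R A'' *m U) j j < 0
                        else 0 < (toR R A'' *m U) j j }.

Section Solutions.
Variables (q : 'cV[R]_n) (U : 'M[R]_(n, d)) (o : {ffun 'I_d -> bool}).
Hypothesis dualU : dual_system q U o.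

Lemma dual_diag_neq0 j : (toR R A'' *m U) j j != 0.
Proof. by have := dual_sign dualU j; case: (o j) => [/lt_eqF | /gt_eqF] ->. Qed.

Lemma dual_mulmx (l : 'cV[R]_d) j :
  (toR R A'' *m (U *m l)) j 0 = (toR R A'' *m U) j j * l j 0.
Proof.
rewrite mulmxA mxE (bigD1 j) //= big1 ?addr0 // => k kj.
by rewrite (dual_offdiag dualU) ?mul0r // eq_sym.
Qed.

Lemma dual_row_free : row_free U^T.
Proof.
apply: inj_row_free => v vU; apply/rowP=> j; rewrite mxE.
have Uv : U *m v^T = 0 by rewrite -[U]trmxK -trmx_mul vU trmx0.
have /eqP := dual_mulmx v^T j.
rewrite Uv mulmx0 [v^T _ _]mxE [X in X == _]mxE eq_sym mulf_eq0.
by rewrite (negPf (dual_diag_neq0 j)) => /eqP.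
Qed.

(** Dimension count: the columns of [U] are independent and lie in the kernel of [A'], whose
    dimension is [n - p = d], so they span it. *)
Lemma dual_span (x : 'cV[R]_n) :
  toR R A' *m x = toR R b' -> exists l : 'cV[R]_d, x = q + U *m l.
Proof.
move=> Ax; set K := kermx (toR R A')^T.
have UK : (U^T <= K)%MS.
  by apply/sub_kermxP; rewrite -trmx_mul (dual_eqs dualU) trmx0.
have /eqmxP UKeq : (U^T == K)%MS.
  rewrite -(mxrank_leqif_eq UK) mxrank_ker !mxrank_tr.
  have /eqP -> := freeA'; have /eqP := dual_row_free.
  by rewrite mxrank_tr => ->; rewrite n_def addnK.
have : ((x - q)^T <= U^T)%MS.
  rewrite UKeq; apply/sub_kermxP; rewrite -trmx_mul mulmxBr Ax.
  by rewrite (dual_apex_eqs dualU) subrr trmx0.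
case/submxP=> D /(congr1 trmx); rewrite trmx_mul !trmxK => xE.
by exists D^T; rewrite -xE addrC subrK.
Qed.

Lemma dual_unique (x : 'cV[R]_n) :
  (toR R A' *m x = toR R b' /\ toR R A'' *m x = toR R b'') <-> x = q.
Proof.
split=> [[/dual_span[l ->] E] | ->]; last by case: dualU.
suff -> : l = 0 by rewrite mulmx0 addr0.
apply/colP=> j; move: E; rewrite mulmxDr (dual_apex_ineqs dualU).
rewrite -[RHS]addr0 => /addrI/colP/(_ j); rewrite dual_mulmx => /eqP.
rewrite [X in _ == X]mxE mulf_eq0 (negPf (dual_diag_neq0 j)) => /eqP ->.
by rewrite mxE.
Qed.

(** The slack of row [j] at [q + U *m l] is the [j]-th diagonal entry times [l j 0]. This entry is
    negative when [o j] holds, which turns the reversed strict inequality into a positive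
    coefficient. *)
Lemma dual_system_setE : system_set A' b' A'' b'' o =
  [set x | exists2 lam : 'I_d -> R,
     forall j, if o j then 0 < lam j else 0 <= lam j &
     x = q + \sum_j lam j *: col j U].
Proof.
have sgeE (l : 'cV[R]_d) j :
    sge (o j) ((toR R A'' *m (q + U *m l)) j 0) (toR R b'' j 0) =
    if o j then 0 < l j 0 else 0 <= l j 0.
  rewrite mulmxDr (dual_apex_ineqs dualU) mxE dual_mulmx /sge.
  have := dual_sign dualU j; case: (o j) => D0.
    by rewrite gtrDl nmulr_rlt0.
  by rewrite lerDl pmulr_rge0.
apply/seteqP; split=> x /=.
  case=> /dual_span[l ->] xge; exists (fun j => l j 0) => [j|].
    by rewrite -sgeE; apply: xge.
  by rewrite sum_colE; congr (_ + _ *m _); apply/colP=> j; rewrite mxE.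
case=> lam lam0 ->; rewrite sum_colE; split.
  by rewrite mulmxDr mulmxA (dual_eqs dualU) mul0mx addr0 (dual_apex_eqs dualU).
by move=> j; rewrite sgeE mxE; apply: lam0.
Qed.

End Solutions.

Variable C : symcone R n d.
Hypothesis dualC : dual_system (apex C) (toR R (gens C)) (openness C).

Lemma dual_cone_set : cone_set C = system_set A' b' A'' b'' (openness C).
Proof.
rewrite (dual_system_setE dualC); apply/seteqP; split=> x [lam lam0 ->];
  exists lam => //; congr (_ + _); apply: eq_bigr => j _; by rewrite toR_col.
Qed.

Lemma dual_rows_ordered : rows_ordered A' b' A'' b'' C.
Proof.
move=> j lam lam0 x.
have xE : x = apex C + toR R (gens C) *m (lam *: delta_mx j 0).
  by rewrite -scalemxAr -colE -toR_col.
have Ax l : (toR R A'' *m x) l 0 = toR R b'' l 0 +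
    (toR R A'' *m toR R (gens C)) l l * (lam * (l == j)%:R).
  rewrite xE mulmxDr (dual_apex_ineqs dualC) mxE (dual_mulmx dualC).
  by congr (_ + _ * _); rewrite !mxE eqxx andbT.
split.
- rewrite xE mulmxDr (dual_apex_eqs dualC) mulmxA (dual_eqs dualC).
  by rewrite mul0mx addr0.
- by move=> l lj; rewrite Ax (negPf lj) !mulr0 addr0.
- rewrite Ax eqxx mulr1 -subr_eq0 addrAC subrr add0r.
  by rewrite mulf_neq0 ?(gt_eqF lam0) // (dual_diag_neq0 dualC).
- rewrite Ax eqxx mulr1 /sge; have := dual_sign dualC j.
  case: (openness C j) => D0; first by rewrite gtrDl nmulr_rlt0.
  by rewrite lerDl pmulr_rge0 // ltW.
Qed.

(** Negating the generators with openness 1 makes every diagonal entry positive, which gives the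
    closed simplicial cone of the same rows. As [C] is forward, exactly the negated columns are not
    forward, so [Flip] restores [C]. *)
Lemma dual_forward_cone_determined :
  (forall j, primitive (col j (gens C))) -> forward_cone C ->
  forward_cone_determined A' b' A'' b'' C.
Proof.
move=> primC fwdC.
pose V0 : 'M[int]_(n, d) :=
  \matrix_(c, j) (if openness C j then - gens C c j else gens C c j).
pose C0 : symcone R n d := (V0, apex C, [ffun=> false]).
have colV0 j : col j V0 =
    if openness C j then - col j (gens C) else col j (gens C).
  by apply/colP=> c; rewrite !mxE; case: ifP; rewrite !mxE.
have AV0 (k : nat) (B : 'M[int]_(k, n)) l j : (toR R B *m toR R V0) l j =
    (-1) ^+ openness C j * (toR R B *m toR R (gens C)) l j.
  rewrite !mxE mulr_sumr; apply: eq_bigr => c _; rewrite !mxE mulrCA.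
  by case: (openness C j); rewrite ?mul1r // mulN1r rmorphN.
have dual0 : dual_system (apex C) (toR R V0) [ffun=> false].
  case: dualC => AV Aq Aq' off sgnC; split=> //.
  - by apply/matrixP=> l j; rewrite AV0 AV !mxE mulr0.
  - by move=> l j lj; rewrite AV0 off // mulr0.
  - move=> j; rewrite ffunE AV0; have := sgnC j.
    by case: (openness C j); rewrite ?mul1r // mulN1r oppr_gt0.
have free0 := dual_row_free dual0.
have KE := dual_system_setE dual0.
have {}KE : system_set A' b' A'' b'' [ffun=> false] =
    [set x | exists2 lam : 'I_d -> R, forall j, 0 <= lam j &
             x = apex C + \sum_j lam j *: col j (toR R V0)].
  rewrite KE; apply/seteqP; split=> x [lam lam0 ->];
    exists lam => // j; have := lam0 j; by rewrite ffunE.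
exists C0; last first.
  transitivity (gens C, apex C, openness C); first by case: (C) => [[? ?] ?].
  have fwdV0 j : forward (col j V0) = ~~ openness C j.
    rewrite colV0; case: (openness C j); last by rewrite fwdC.
    by rewrite forwardN ?forward_neq0 ?fwdC.
  congr (_, _, _).
    apply/matrixP=> c j; rewrite mxE fwdV0 mxE.
    by case: (openness C j); rewrite //= opprK.
  by apply/ffunP=> j; rewrite !ffunE fwdV0; case: (openness C j).
split=> //.
- by split=> //; exists (apex C), (toR R V0).
- exact: dual_unique dual0.
- move=> j; split.
    by rewrite colV0; case: ifP; rewrite ?primitiveN primC.
  by rewrite KE /= toR_col; apply: generator_extreme_ray.
- move=> F; rewrite KE => /(extreme_rayP free0)[j [FE Fu]].
  exists j; split=> [|j']; rewrite /= toR_col //; exact: Fu.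
Qed.

End DualSystem.

(** * Lifting cones to the solution space of [ext_mx A *m x = b] *)

Lemma mul_ext_mx (T : pzRingType) m d k (A : 'M[T]_(m, d)) (Z : 'M[T]_(d + m, k)) :
  row_mx A (- 1%:M) *m Z = A *m usubmx Z - dsubmx Z.
Proof. by rewrite -{1}[Z]vsubmxK mul_row_col mulNmx mul1mx. Qed.

Lemma toR_ext_mx (R : realType) d m (A : 'M[int]_(m, d)) :
  toR R (ext_mx A) = row_mx (toR R A) (- 1%:M).
Proof. by rewrite /toR /ext_mx map_row_mx map_mxN map_mx1. Qed.

Lemma toR_mulmx (R : realType) m n k (A : 'M[int]_(m, n)) (B : 'M[int]_(n, k)) :
  toR R (A *m B) = toR R A *m toR R B.
Proof. exact: map_mxM. Qed.

Section Frames.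
Variables (R : realType) (d m : nat) (A : 'M[int]_(m, d)) (b : 'cV[int]_m).

(* C is the truncation to the first n coordinates of a cone with generators X
   and apex Q in R^(d+m), contained in the subspace [ext_mx A *m x = b]. On that
   subspace the rows of [ineqs_mx] and [ineqs_rhs] are the coordinates with index
   below d or at least n; f selects the d of them that cut out C. *)
Record frame n (C : symcone R n d) (X : 'M[int]_(d + m, d)) (Q : 'cV[R]_(d + m))
    (f : 'I_d -> 'I_(d + m)) (w : 'I_n -> 'I_(d + m)) : Prop := Frame {
  frame_trunc : forall c, w c = c :> nat;
  frame_gens : gens C = rowsub w X;
  frame_apex : apex C = rowsub w Q;
  frame_gens_eqs : ext_mx A *m X = 0;
  frame_apex_eqs : toR R (ext_mx A) *m Q = toR R b;
  frame_inj : injective f;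
  frame_range : forall l, (f l < d)%N || (n <= f l)%N;
  frame_offdiag : forall l j, l != j -> X (f l) j = 0;
  frame_sign : forall j, if openness C j then X (f j) j < 0 else 0 < X (f j) j;
  frame_tight : forall l, Q (f l) 0 = 0 }.

Definition framed n (C : symcone R n d) : Prop := exists X Q f w, frame C X Q f w.

(** As [d <= n], the first [d] entries of a lifted column survive truncation; the others are integer
    combinations of these, given by the rows of [A]. *)
Lemma frame_dvd n (C : symcone R n d) X Q f w : (d <= n)%N -> frame C X Q f w ->
  forall c j, ((col_gcd (col j (gens C)))%:Z %| X c j)%Z.
Proof.
move=> dn [wE gE _ eqX _ _ _ _ _ _] c j; set g := (col_gcd _)%:Z.
have lowdvd l : (g %| X (lshift m l) j)%Z.
  have ln : (l < n)%N by apply: leq_trans dn.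
  have := dvdn_col_gcd (col j (gens C)) (Ordinal ln).
  have -> : lshift m l = w (Ordinal ln) by apply: ord_inj; rewrite wE.
  by rewrite {2}gE !mxE dvdzE.
case: (split_ordP c) => [l | r] ->; first exact: lowdvd.
have /matrixP/(_ r j) := eqX; rewrite mul_ext_mx !mxE => /eqP.
rewrite subr_eq0 => /eqP <-; apply: rpred_sum => l _.
by rewrite mxE dvdz_mull.
Qed.

(** The gcd of a truncated column divides the full column, so the lift can be divided along with it;
    a positive factor affects neither zeros nor signs. *)
Lemma framed_prim n (V : 'M[int]_(n, d)) q o : (d <= n)%N ->
  framed (V, q, o) ->
  framed (prim V, q, o) /\ forall j, primitive (col j (prim V)).
Proof.
move=> dn [X [Q [f [w F]]]]; have dvdX := frame_dvd dn F.
case: F => wE gE aE eqX eqQ fI fR offX sgnX Q0.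
(* A zero truncated column has gcd 0, which cannot divide the nonzero entry [X (f j) j]. *)
have V0 j : col j V != 0.
  apply/eqP=> V0; have := dvdX (f j) j; have := sgnX j.
  have /eqP : col_gcd (col j V) == 0%N by rewrite col_gcd_eq0 V0.
  rewrite /gens /= => -> sX; rewrite dvd0z => /eqP X0.
  by move: sX; rewrite X0 ltxx; case: ifP.
pose g j : int := (col_gcd (col j V))%:Z.
have g0 j : 0 < g j by rewrite /g ltz_nat lt0n col_gcd_eq0.
pose X' : 'M[int]_(d + m, d) := \matrix_(c, j) (X c j %/ g j)%Z.
have XE c j : X c j = X' c j * g j by rewrite mxE divzK //; apply: dvdX.
split=> [|j]; last exact: primitive_prim.
exists X', Q, f, w; split=> //.
- apply/matrixP=> c j; rewrite /gens /= !mxE.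
  by have /matrixP/(_ c j) := gE; rewrite mxE /gens /= => ->.
- apply/matrixP=> r j; rewrite [RHS]mxE; apply/eqP.
  suff: (ext_mx A *m X') r j * g j == 0 by rewrite mulf_eq0 (gt_eqF (g0 j)) orbF.
  have /matrixP/(_ r j) := eqX; rewrite !mxE mulr_suml => X0.
  by apply/eqP; rewrite -[RHS]X0; apply: eq_bigr => c _; rewrite -mulrA -XE.
- by move=> l j /offX/eqP; rewrite XE mulf_eq0 (gt_eqF (g0 j)) orbF => /eqP.
- move=> j; have := sgnX j; rewrite /openness /= XE.
  by rewrite pmulr_llt0 // pmulr_lgt0.
Qed.

Lemma framed_Flip n (C : symcone R n d) : framed C -> framed (Flip C).
Proof.
case=> X [Q [f [w [wE gE aE eqX eqQ fI fR offX sgnX Q0]]]].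
pose s j : int := if forward (col j (gens C)) then 1 else -1.
exists (\matrix_(c, j) (s j * X c j)), Q, f, w; split=> //.
- apply/matrixP=> c j; rewrite /gens /= !mxE /s.
  by case: ifP; rewrite gE mxE ?mul1r ?mulN1r.
- apply/matrixP=> r j; have /matrixP/(_ r j) := eqX; rewrite !mxE => X0.
  rewrite -[RHS](mulr0 (s j)) -[X in _ = _ * X]X0 mulr_sumr; apply: eq_bigr => c _.
  by rewrite mxE mulrCA.
- by move=> l j /offX X0; rewrite mxE X0 mulr0.
- move=> j; have := sgnX j; rewrite /openness /= ffunE mxE /s /openness.
  case: (forward _); rewrite ?mul1r // mulN1r.
  by case: (C.2 j); rewrite ?oppr_gt0 ?oppr_lt0.
Qed.

Lemma lex_sort_perm n (C : symcone R n d) :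
  injective (tnth [tuple of sort (col_lexle (gens C)) (ord_tuple d)]).
Proof.
apply/tuple_uniqP; rewrite /= sort_uniq.
exact: enum_uniq.
Qed.

Lemma framed_lex_sort n (C : symcone R n d) : framed C -> framed (lex_sort C).
Proof.
case=> X [Q [f [w [wE gE aE eqX eqQ fI fR offX sgnX Q0]]]].
have := @lex_sort_perm n C; rewrite /lex_sort.
set s := tnth _ => sI.
exists (colsub s X), Q, (f \o s), w; split=> //.
- by apply/matrixP=> c j; rewrite {1}/gens /= !mxE gE mxE.
- apply/matrixP=> r j; have := eqX => /matrixP/(_ r (s j)); rewrite !mxE => X0.
  by rewrite -[RHS]X0; apply: eq_bigr => c _; congr (_ * _); rewrite mxE.
- exact: inj_comp.
- by move=> l; apply: fR.
- by move=> l j lj; rewrite mxE offX // (inj_eq sI).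
- by move=> j; rewrite /openness /= ffunE mxE; apply: sgnX.
- by move=> l; apply: Q0.
Qed.

(** The invariant of the elimination. Primitivity and forwardness identify the columns as flipped
    primitive generators of extreme rays. *)
Definition tracked n (C : symcone R n d) : Prop :=
  [/\ framed C, forall j, primitive (col j (gens C)) & forward_cone C].

(** Both [elim_base] and [elim_piece] have generators of the form [prim V], so this treats every
    cone that a step outputs. *)
Lemma tracked_output n (V : 'M[int]_(n, d)) q o : (d <= n)%N ->
  framed (V, q, o) -> tracked (lex_sort (Flip (prim V, q, o))).
Proof.
move=> dn /(framed_prim dn)[frP primP].
set C := (prim V, q, o) in frP *.
have colF j : col j (gens (Flip C)) =
    if forward (col j (prim V)) then col j (prim V) else - col j (prim V).
  by apply/colP=> c; rewrite !mxE; case: ifP; rewrite ?mxE.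
have colS j : exists k, col j (gens (lex_sort (Flip C))) = col k (gens (Flip C)).
  by eexists; apply/colP=> c; rewrite !mxE.
split=> [|j|j]; first exact/framed_lex_sort/framed_Flip.
  by have [k ->] := colS j; rewrite colF; case: ifP; rewrite ?primitiveN.
have [k ->] := colS j; rewrite colF; case: ifPn => // nf.
by rewrite forwardN //; have /andP[] := primP k.
Qed.

(** * One elimination step and its iteration *)

Section Step.
Variables (n : nat) (C : symcone R n.+1 d).

(** The lift and the selected coordinates stay the same: truncating further only enlarges the set of
    admissible coordinates. *)
Lemma framed_proj_last : framed C ->
  framed (proj_last (gens C), proj_last (apex C), openness C).
Proof.
case=> X [Q [f [w [wE gE aE eqX eqQ fI fR offX sgnX Q0]]]].
exists X, Q, f, (w \o lift ord_max); split=> //.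
- by move=> c; rewrite wE lift_max.
- by apply/matrixP=> c j; rewrite gE !mxE.
- by apply/colP=> c; rewrite aE !mxE.
- by move=> l; case/orP: (fR l) => [-> // | /ltnW ->]; rewrite orbT.
Qed.

(** This is a fraction-free pivot: for [l != j] the combination of columns [j] and [l] cancels the
    last coordinate of the generators. *)
Lemma mulmx_elim_mx k (X : 'M[int]_(k, d)) c j l :
  (X *m elim_mx C j) c l =
  if l == j then - X c j
  else gens C ord_max l * X c j - gens C ord_max j * X c l.
Proof.
rewrite mxE (bigD1 j) //= mxE eqxx; case: eqVneq => [-> | lj].
  rewrite big1 => [|a aj]; first by rewrite addr0 mulrN1.
  by rewrite mxE (negPf aj) eq_sym (negPf aj) mulr0.
rewrite (bigD1 l) //= big1 => [|a /andP[aj al]].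
  by rewrite mxE (negPf lj) eqxx addr0 mulrN mulrC [X c l * _]mulrC.
by rewrite mxE (negPf aj) eq_sym (negPf al) mulr0.
Qed.

(* The j-th constraint is replaced by nonnegativity of the eliminated
   coordinate. *)
Lemma framed_elim_piece j : (d <= n)%N ->
  (if 0 <= apex C ord_max 0 then gens C ord_max j < 0
   else 0 < gens C ord_max j) ->
  framed C ->
  framed (proj_last (sg (apex C ord_max 0) *: (gens C *m elim_mx C j)),
          proj_last (elim_apex C j), elim_open C j).
Proof.
move=> dn vj [X [Q [f [w [wE gE aE eqX eqQ fI fR offX sgnX Q0]]]]].
set s := sg _; set e := w ord_max.
have eE : e = n :> nat by rewrite wE.
have vE l : gens C ord_max l = X e l by rewrite gE mxE.
have qE : apex C ord_max 0 = Q e 0 by rewrite aE mxE.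
have sv : s * X e j < 0.
  by move: vj; rewrite /s /sg vE; case: ifP; rewrite ?mul1r // mulN1r oppr_lt0.
have v0 : X e j != 0 by apply: contraTneq sv => ->; rewrite mulr0 ltxx.
(* The index [n] of [e] is neither below [d] nor at least [n.+1], so [e] was not selectable before
   this step. *)
have fe l : f l != e.
  by apply/eqP=> fle; have := fR l; rewrite fle eE ltnNge dn ltnn.
(* The pivot acts on the full generators, and the apex slides along column [j] until coordinate [e]
   vanishes; [e] then replaces [f j]. *)
exists (s *: (X *m elim_mx C j)).
exists (Q - (Q e 0 / (X e j)%:~R) *: toR R (col j X)).
exists (fun l => if l == j then e else f l), (w \o lift ord_max).
have TE c l : (s *: (X *m elim_mx C j)) c l =
    s * (if l == j then - X c j else X e l * X c j - X e j * X c l).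
  by rewrite mxE mulmx_elim_mx !vE.
have QE c : (Q - (Q e 0 / (X e j)%:~R) *: toR R (col j X)) c 0 =
    Q c 0 - Q e 0 / (X e j)%:~R * (X c j)%:~R.
  by rewrite !mxE.
split.
- by move=> c; rewrite /= wE lift_max.
- apply/matrixP=> c l; rewrite [RHS]mxE TE [LHS]mxE mxE mulmx_elim_mx !vE.
  by rewrite gE !mxE.
- apply/colP=> c; rewrite [RHS]mxE QE [LHS]mxE /elim_apex qE vE !mxE aE gE.
  by rewrite !mxE.
- by rewrite -scalemxAr mulmxA eqX mul0mx scaler0.
- rewrite mulmxBr eqQ -scalemxAr toR_col colE mulmxA -toR_mulmx eqX.
  by rewrite /toR map_mx0 mul0mx scaler0 subr0.
- move=> k l; case: eqVneq => [-> | kj]; case: eqVneq => [-> | lj] //.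
  + by move/esym/eqP; rewrite (negPf (fe _)).
  + by move/eqP; rewrite (negPf (fe _)).
  + exact: fI.
- move=> l; case: eqVneq => _; first by rewrite eE leqnn orbT.
  by case/orP: (fR l) => [-> // | /ltnW ->]; rewrite orbT.
- move=> k l kl; rewrite TE; case: (eqVneq k j) => [kj | kj].
    by rewrite kj eq_sym in kl; rewrite (negPf kl) [X e l * _]mulrC subrr mulr0.
  rewrite (offX k j) // (offX k l) // !mulr0 subrr oppr0.
  by case: ifP; rewrite mulr0.
(* The new [j]-th diagonal entry is the positive number [- (s * X e j)], matching openness 0 there;
   the other diagonal entries are multiplied by this same number. *)
- move=> l; rewrite TE /openness /= ffunE; case: eqVneq => [_ | lj].
    by rewrite mulrN oppr_gt0.
  have -> : s * (X e l * X (f l) j - X e j * X (f l) l) =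
            - (s * X e j) * X (f l) l.
    by rewrite offX // mulr0 sub0r mulrN mulrA mulNr.
  by rewrite pmulr_rlt0 ?pmulr_rgt0 ?oppr_gt0 //; apply: sgnX.
- move=> l; rewrite QE; case: eqVneq => [_ | lj].
    by rewrite divfK ?subrr // intr_eq0.
  by rewrite Q0 offX // mulr0 subrr.
Qed.

Lemma tracked_ElimLC D : (d <= n)%N -> framed C ->
  D \in unzip2 (ElimLC C) -> tracked (lex_sort D).
Proof.
move=> dn frC /mapP[_ /mapP[B Bin ->] ->] /=.
have piece j : (if 0 <= apex C ord_max 0 then gens C ord_max j < 0
                else 0 < gens C ord_max j) ->
    tracked (lex_sort (Flip (elim_piece C j))).
  by move=> vj; apply: tracked_output => //; apply: framed_elim_piece.
move: Bin; rewrite mem_undup; case: ifP => q0.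
  rewrite mem_rcons inE => /orP[/eqP -> | /mapP[j]].
    by apply: tracked_output => //; apply: framed_proj_last.
  by rewrite mem_filter => /andP[vj _] ->; apply: piece; rewrite q0.
case/mapP=> j; rewrite mem_filter => /andP[vj _] ->.
by apply: piece; rewrite q0.
Qed.

End Step.

(** Collecting terms changes multiplicities only, so each cone of the result is a sorted output of
    [ElimLC] on some term. *)
Lemma tracked_elim_step_pred n (L : lincomb (symcone R n d)) : (d < n)%N ->
  (forall C, C \in unzip2 L -> tracked C) ->
  forall C, C \in unzip2 (elim_step_pred L) -> tracked C.
Proof.
case: n L => // n L dn trL C.
rewrite /= /elim_step /unzip2 /collect -map_comp map_id_in ?mem_undup //.
case/mapP=> _ /flatten_mapP[t tL /mapP[u uE ->]] ->.
apply: (@tracked_ElimLC _ t.2) => //; last exact: map_f.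
by case: (trL t.2) => //; apply: map_f.
Qed.

Lemma tracked_Elim (C : symcone R (d + m) d) i : (i <= m)%N -> tracked C ->
  forall C', C' \in unzip2 (Elim C i) -> tracked C'.
Proof.
have tr_cast n n' (E : n = n') (L : lincomb (symcone R n d)) :
    (forall D, D \in unzip2 L -> tracked D) ->
    forall D, D \in unzip2 (ecast k (lincomb (symcone R k d)) E L) -> tracked D.
  by case: n' / E.
move=> im trC; elim: i im => [|i IHi] im /=; apply: tr_cast.
  by move=> D; rewrite inE => /eqP ->.
apply: tracked_elim_step_pred; last exact/IHi/ltnW.
by rewrite -addnBA ?(ltnW im) // -[X in (X < _)%N]addn0 ltn_add2l subn_gt0.
Qed.

End Frames.

(** * The initial cone and its projection onto the nonnegative orthant *)

Section InitialCone.
Variables (R : realType) (d m : nat) (A : 'M[int]_(m, d)) (b : 'cV[int]_m).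
Variable C : symcone R (d + m) d.
Hypothesis openC : openness C = [ffun=> false].
Hypothesis setC : cone_set C =
  [set x : 'cV[R]_(d + m) | toR R (ext_mx A) *m x = toR R b /\
     forall j : 'I_d, 0 <= ((row_mx 1%:M 0 : 'M[R]_(d, d + m)) *m x) j 0].

Let V := toR R (gens C).
Let V1 : 'M[R]_d := usubmx V.

Let lowE (x : 'cV[R]_(d + m)) :
  (row_mx 1%:M 0 : 'M[R]_(d, d + m)) *m x = usubmx x.
Proof. by rewrite -{1}[x]vsubmxK mul_row_col mul1mx mul0mx addr0. Qed.

Let inC (l : 'cV[R]_d) : (forall j, 0 <= l j 0) ->
  toR R (ext_mx A) *m (apex C + V *m l) = toR R b /\
  forall j, 0 <= usubmx (apex C) j 0 + (V1 *m l) j 0.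
Proof.
move=> l0; have : cone_set C (apex C + V *m l).
  exists (fun j => l j 0) => [j|]; first by rewrite openC ffunE.
  under eq_bigr do rewrite toR_col.
  by rewrite sum_colE; congr (_ + _ *m _); apply/colP=> j; rewrite mxE.
rewrite setC => -[-> q0]; split=> // j; have := q0 j.
by rewrite lowE linearD /= -mul_usub_mx mxE.
Qed.

(** A point [y] of the orthant lifts to the solution whose last [m] coordinates are [A y - b]. *)
Let Cin (y : 'cV[R]_d) : (forall j, 0 <= y j 0) ->
  exists2 l : 'cV[R]_d, forall j, 0 <= l j 0 & y = usubmx (apex C) + V1 *m l.
Proof.
move=> y0; have : cone_set C (col_mx y (toR R A *m y - toR R b)).
  rewrite setC; split; last by move=> j; rewrite lowE col_mxKu.
  by rewrite toR_ext_mx mul_ext_mx col_mxKu col_mxKd subKr.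
case=> lam lam0.
under eq_bigr do rewrite toR_col.
rewrite sum_colE => /(congr1 usubmx); rewrite col_mxKu => ->.
exists (\col_j lam j) => [j|]; first by have := lam0 j; rewrite openC ffunE mxE.
by rewrite linearD /= -mul_usub_mx.
Qed.

(** The first [d] coordinates map the cone onto the orthant. Hence [V1] is nonnegative, the apex
    projects to 0, and expressing the unit vectors by generators gives a nonnegative inverse of
    [V1]. The nonzero pattern of [V1] then supplies the selected coordinates. *)
Lemma framed_initial : framed A b C.
Proof.
have d0 j l : 0 <= (delta_mx j 0 : 'cV[R]_d) l 0 by rewrite mxE ler0n.
have [eqq q0] : toR R (ext_mx A) *m apex C = toR R b /\
    forall j, 0 <= usubmx (apex C) j 0.
  have [|] := inC (l := 0); first by move=> j; rewrite mxE.
  rewrite !mulmx0 addr0 => -> q0; split=> // j.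
  by have := q0 j; rewrite [X in _ + X]mxE addr0.
have eqV : ext_mx A *m gens C = 0.
  apply/matrixP=> r j; have [+ _] := inC (d0 j).
  rewrite mulmxDr eqq -[RHS]addr0 => /addrI.
  rewrite mulmxA -toR_mulmx -colE => /colP/(_ r).
  by rewrite mxE [LHS]mxE !mxE => /eqP; rewrite intr_eq0 => /eqP.
have V10 l j : 0 <= V1 l j.
  apply: (@ge0_of_half_line _ (usubmx (apex C) l 0)) => t t0.
  have [|_ /(_ l)] := inC (l := t *: delta_mx j 0).
    by move=> k; rewrite mxE mulr_ge0.
  by rewrite -scalemxAr -colE [X in _ + X]mxE [X in _ + _ * X]mxE.
(* The origin of the orthant is the projected apex plus a nonnegative vector, and the projected apex
   is itself nonnegative. *)
have q_eq0 : usubmx (apex C) = 0.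
  have [|l l0] := Cin (y := 0); first by move=> j; rewrite mxE.
  move=> /esym/colP E; apply/colP=> j; rewrite [RHS]mxE.
  have := E j; rewrite [RHS]mxE [LHS]mxE => /eqP.
  rewrite paddr_eq0 //; first by case/andP=> /eqP.
  by rewrite mxE sumr_ge0 // => k _; rewrite mulr_ge0.
have [L LE] : exists L : 'I_d -> 'cV[R]_d, forall c,
    (forall j, 0 <= L c j 0) /\ delta_mx c 0 = V1 *m L c.
  apply: (@fin_all_exists _ _ (fun c (l : 'cV[R]_d) =>
    (forall j, 0 <= l j 0) /\ delta_mx c 0 = V1 *m l)) => c.
  have [l l0] := Cin (d0 c).
  by rewrite q_eq0 add0r => E; exists l.
pose Lam : 'M[R]_d := \matrix_(j, c) L c j 0.
have Lam0 j c : 0 <= Lam j c by rewrite mxE; case: (LE c).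
have VL : V1 *m Lam = 1%:M.
  apply/matrixP=> a c; have [_ /colP/(_ a)] := LE c.
  rewrite !mxE eqxx andbT => ->; apply: eq_bigr => k _.
  by rewrite [Lam _ _]mxE.
have VL0 l c j : l != c -> V1 l j * Lam j c = 0.
  move=> lc; have /matrixP/(_ l c) := VL; rewrite mxE [RHS]mxE (negPf lc).
  move/eqP; rewrite psumr_eq0 => [/allP/(_ j)|k _]; last by rewrite mulr_ge0.
  by rewrite mem_index_enum => /(_ isT) /eqP.
have LV := mulmx1C VL.
(* A nonnegative matrix with a nonnegative inverse is monomial. *)
have [f fE] : exists f : 'I_d -> 'I_d, forall j,
    [/\ V1 (f j) j != 0, Lam j (f j) != 0 & forall l, l != f j -> V1 l j = 0].
  apply: (@fin_all_exists _ _ (fun j l => [/\ V1 l j != 0, Lam j l != 0 &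
                                 forall l', l' != l -> V1 l' j = 0])) => j.
  have [l lE] : exists l, Lam j l * V1 l j != 0.
    apply/existsP; apply: contraT; rewrite negb_exists => /forallP all0.
    have /matrixP/(_ j j) := LV; rewrite mxE big1 => [|l _].
      by rewrite mxE eqxx => /eqP; rewrite eq_sym oner_eq0.
    by apply/eqP; have := all0 l; rewrite negbK.
  move: lE; rewrite mulf_eq0 negb_or => /andP[Ljl Vlj].
  exists l; split=> // l' /(VL0 l' l j)/eqP.
  by rewrite mulf_eq0 (negPf Ljl) orbF => /eqP.
have fI : injective f.
  move=> j k fjk; have [_ Ljj _] := fE j; have [Vkk _ V0] := fE k.
  apply/eqP; apply: contraT => jk.
  (* If [f j = f k], index [f k] contributes the only nonzero term to the off-diagonal entry
     [(j, k)] of [Lam *m V1]. *)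
  have /matrixP/(_ j k) := LV; rewrite mxE [RHS]mxE (negPf jk).
  rewrite (bigD1 (f k)) //= big1 => [|l /V0 ->]; last by rewrite mulr0.
  by move/eqP; rewrite addr0 mulf_eq0 (negPf Vkk) -fjk (negPf Ljj).
have V1E l j : V1 l j = (gens C (lshift m l) j)%:~R by rewrite !mxE.
exists (gens C), (apex C), (lshift m \o f), id; split=> //.
- by apply/matrixP=> c j; rewrite mxE.
- by apply/colP=> c; rewrite mxE.
- exact: inj_comp (@lshift_inj _ _) fI.
- by move=> l; rewrite /= ltn_ord.
- move=> l j lj; have [_ _ V0] := fE j; apply/eqP.
  by rewrite -(intr_eq0 R) -V1E V0 // (inj_eq fI).
- move=> j; rewrite openC ffunE -(ltr0z R) -V1E lt_def V10 andbT.
  by case: (fE j).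
- by move=> l; have /colP/(_ (f l)) := q_eq0; rewrite !mxE.
Qed.

End InitialCone.

(** * The system in the remaining coordinates *)

Section TruncatedSystem.
Variables (R : realType) (d m i : nat) (him : (i <= m)%N) (A : 'M[int]_(m, d)).

(** On the solution space, the slack of row [s] equals this coordinate: a bottom row [t] has lost
    its column [d + t], so its slack is [x_(d+t)]. *)
Definition ineq_coord (s : 'I_(d + i)) : 'I_(d + m) :=
  match split s with
  | inl l => lshift m l
  | inr r => rshift d (bottom_row him r)
  end.

Lemma ineq_coord_onto (c : 'I_(d + m)) :
  (c < d)%N || (d + m - i <= c)%N -> exists s, ineq_coord s = c.
Proof.
case: (split_ordP c) => [l -> _ | t -> /=].
  by exists (lshift i l); rewrite /ineq_coord (unsplitK (inl l)).
rewrite -addnBA // leq_add2l => mit.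
have ti : (t - (m - i) < i)%N by rewrite ltn_subLR // subnK.
exists (rshift d (Ordinal ti)); rewrite /ineq_coord (unsplitK (inr _)).
by congr (rshift d _); apply: ord_inj; rewrite /= subnKC.
Qed.

(** The entry [-1] of row [t] sits in column [d + t]. That column survives truncation exactly when
    [t < m - i]; otherwise its contribution must be added back. *)
Lemma truncated_row k (Z : 'M[R]_(d + m, k)) (t : 'I_m) j :
  \sum_(c < d + m - i) toR R (ext_mx A) t (first_col c) * Z (first_col c) j =
  (toR R (ext_mx A) *m Z) t j +
  (if (t < m - i)%N then 0 else Z (rshift d t) j).
Proof.
rewrite -(big_ord_narrow (F := fun c => toR R (ext_mx A) t c * Z c j)
           (leq_subr i (d + m))) big_mkcond mxE !big_split_ord /= -addrA.
congr (_ + _).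
  apply: eq_bigr => l _; case: ifPn => //; rewrite -leqNgt -addnBA //.
  by move/(leq_trans (leq_addr _ _)); rewrite leqNgt ltn_ord.
have extE s : toR R (ext_mx A) t (rshift d s) = - (t == s)%:R.
  by rewrite toR_ext_mx row_mxEr !mxE.
rewrite (bigD1 t) //= big1 => [|s st]; last first.
  by rewrite extE eq_sym (negPf st) oppr0 mul0r; case: ifP.
rewrite [X in _ = X + _](bigD1 t) //= big1 => [|s st]; last first.
  by rewrite extE eq_sym (negPf st) oppr0 mul0r.
rewrite extE eqxx mulN1r !addr0 -addnBA // ltn_add2l; case: ifP => _; first by rewrite addr0.
by rewrite addNr.
Qed.

Lemma mul_eqs_mx k (Z : 'M[R]_(d + m, k)) :
  toR R (eqs_mx him A) *m rowsub (@first_col d m i) Z =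
  rowsub (top_row him) (toR R (ext_mx A) *m Z).
Proof.
apply/matrixP=> r j; rewrite mxE [RHS]mxE.
rewrite -[RHS]addr0.
have := truncated_row Z (top_row him r) j.
rewrite /= ltn_ord => <-.
by apply: eq_bigr => c _; rewrite !mxE.
Qed.

(** Stated for arbitrary [Z] to serve both the generators, where [ext_mx A *m Z] is 0, and the apex,
    where it is [b]. *)
Lemma mul_ineqs_mx k (Z : 'M[R]_(d + m, k)) s j :
  (toR R (ineqs_mx him A) *m rowsub (@first_col d m i) Z) s j =
  Z (ineq_coord s) j +
  (col_mx 0 (rowsub (bottom_row him) (toR R (ext_mx A) *m Z)) : 'M_(d + i, k)) s j.
Proof.
rewrite /ineq_coord; case: (split_ordP s) => [l | r] -> /=.
  rewrite col_mxEu [X in _ + X]mxE addr0 mxE.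
  have ln : (l < d + m - i)%N by rewrite -addnBA // ltn_addr.
  have upE c : toR R (ineqs_mx him A) (lshift i l) c = (l == c :> nat)%:R.
    rewrite [LHS]mxE /ineqs_mx col_mxEu [X in X%:~R]mxE ltn_ord andbT.
    by case: eqP.
  rewrite (bigD1 (Ordinal ln)) //= big1 => [|c cl].
    rewrite upE eqxx mul1r addr0 mxE.
    by congr (Z _ j); apply: ord_inj.
  rewrite upE; case: eqVneq => [lc|]; last by rewrite mul0r.
  by case/eqP: cl; apply: ord_inj; rewrite /= lc.
rewrite col_mxEd [X in _ + X]mxE mxE addrC.
have := truncated_row Z (bottom_row him r) j.
rewrite /= ltnNge leq_addr /= => <-.
apply: eq_bigr => c _; congr (_ * _); last by rewrite mxE.
by rewrite [LHS]mxE /ineqs_mx col_mxEd [RHS]mxE [X in X%:~R]mxE.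
Qed.

(** The last [m - i] columns form the negative of the identity. *)
Lemma row_free_eqs_mx : row_free (toR R (eqs_mx him A)).
Proof.
apply: inj_row_free => v v0; apply/rowP=> r; rewrite mxE.
have rn : (d + r < d + m - i)%N by rewrite -addnBA // ltn_add2l.
have /rowP/(_ (Ordinal rn)) := v0; rewrite mxE [RHS]mxE.
have entE s : toR R (eqs_mx him A) s (Ordinal rn) = - (s == r)%:R.
  rewrite mxE [X in X%:~R]mxE.
  have -> : first_col (Ordinal rn) = rshift d (top_row him r) by apply: ord_inj.
  rewrite /ext_mx row_mxEr !mxE rmorphN /=; congr (- _).
  by rewrite (_ : (top_row him s == top_row him r) = (s == r)) //; case: eqP.
rewrite (bigD1 r) //= big1 => [|s sr]; last first.
  by rewrite entE (negPf sr) oppr0 mulr0.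
by rewrite entE eqxx mulrN1 addr0 => /eqP; rewrite oppr_eq0 => /eqP.
Qed.

Lemma dual_system_of_frame (b : 'cV[int]_m) (C : symcone R (d + m - i) d)
    X Q f w (g : 'I_d -> 'I_(d + i)) :
  frame A b C X Q f w -> (forall l, ineq_coord (g l) = f l) ->
  dual_system (eqs_mx him A) (eqs_rhs him b) (rowsub g (ineqs_mx him A))
    (rowsub g (ineqs_rhs d him b)) (apex C) (toR R (gens C)) (openness C).
Proof.
case=> wE gE aE eqX eqQ fI fR offX sgnX Q0 gf.
have wF : w =1 @first_col d m i by move=> c; apply: ord_inj; rewrite wE.
have VE : toR R (gens C) = rowsub (@first_col d m i) (toR R X).
  by apply/matrixP=> c j; rewrite gE !mxE wF.
have qE : apex C = rowsub (@first_col d m i) Q.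
  by apply/colP=> c; rewrite aE !mxE wF.
have MX : toR R (ext_mx A) *m toR R X = 0 by rewrite -toR_mulmx eqX /toR map_mx0.
have rowE k (Z : 'M[R]_(d + m, k)) l j :
    (toR R (rowsub g (ineqs_mx him A)) *m rowsub (@first_col d m i) Z) l j =
    (toR R (ineqs_mx him A) *m rowsub (@first_col d m i) Z) (g l) j.
  by rewrite !mxE; apply: eq_bigr => c _; rewrite !mxE.
have AVE l j : (toR R (rowsub g (ineqs_mx him A)) *m toR R (gens C)) l j =
    (X (f l) j)%:~R.
  rewrite VE rowE mul_ineqs_mx MX gf [toR R X _ _]mxE.
  suff -> : rowsub (bottom_row him) (0 : 'M[R]_(m, d)) = 0.
    by rewrite col_mx0 mxE addr0.
  by apply/matrixP=> ? ?; rewrite !mxE.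
split.
- by rewrite VE mul_eqs_mx MX; apply/matrixP=> r j; rewrite !mxE.
- by rewrite qE mul_eqs_mx eqQ; apply/matrixP=> r j; rewrite !mxE.
- apply/colP=> l; rewrite qE rowE mul_ineqs_mx gf Q0 add0r eqQ.
  rewrite [RHS]mxE [X in _ = X%:~R]mxE /ineqs_rhs; case: (split_ordP (g l)) => [s | r] -> /=.
    by rewrite !col_mxEu !mxE.
  by rewrite !col_mxEd !mxE.
- by move=> l j lj; rewrite AVE offX.
- by move=> j; rewrite AVE ltrz0 ltr0z; apply: sgnX.
Qed.

End TruncatedSystem.

Theorem theorem4p1 (R : realType) (d m : nat) (hd : (1 <= d)%N) (hm : (1 <= m)%N)
    (A : 'M[int]_(m, d)) (b : 'cV[int]_m) (C : symcone R (d + m) d)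
    (hC : symbolic_cone C)
    (hprim : forall j : 'I_d, primitive (col j (gens C)))
    (hopen : openness C = [ffun=> false])
    (hforward : forward_cone C)
    (hset : cone_set C =
       [set x : 'cV[R]_(d + m) |
          toR R (ext_mx A) *m x = toR R b /\
          forall j : 'I_d, 0 <= ((row_mx 1%:M 0 : 'M[R]_(d, d + m)) *m x) j 0])
    (i : nat) (him : (i <= m)%N) (C' : symcone R (d + m - i) d)
    (hC' : C' \in unzip2 (Elim C i)) :
  exists f : 'I_d -> 'I_(d + i),
    let A' := eqs_mx him A in
    let b' := eqs_rhs him b in
    let A'' := rowsub f (ineqs_mx him A) in
    let b'' := rowsub f (ineqs_rhs d him b) in
    [/\ injective f,
        forward_cone_determined A' b' A'' b'' C',
        rows_ordered A' b' A'' b'' C'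
      & cone_set C' = system_set A' b' A'' b'' (openness C')].
Proof.
have trC : tracked A b C by split=> //; apply: framed_initial hopen hset.
have [[X [Q [f [w F]]]] primC' fwdC'] := tracked_Elim him trC hC'.
(* Every selected coordinate is admissible, hence is the slack of some inequality row; [g] chooses
   these rows. *)
have [g gf] : exists g : 'I_d -> 'I_(d + i), forall l, ineq_coord him (g l) = f l.
  apply: (@fin_all_exists _ _ (fun l s => ineq_coord him s = f l)) => l.
  exact: ineq_coord_onto (frame_range F l).
have dualC' := dual_system_of_frame F gf.
have freeA' := row_free_eqs_mx R him A.
have nE : (d + m - i = d + (m - i))%N by rewrite addnBA.
exists g; split.
- move=> l j glj; apply: (frame_inj F); by rewrite -!gf glj.
- exact: dual_forward_cone_determined.
- exact: dual_rows_ordered dualC'.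
- exact: dual_cone_set dualC'.
Qed.
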